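(* For every $n\geq 1$, the number of $D$-equivalence classes of the set $\mathcal{L}_n$ of Łukasiewicz paths of length $n$ is $2^{n-1}$.
   Context: A Łukasiewicz path of length $n$ is a sequence of $n$ steps from $\{(1,i): i\geq -1\}$ starting at $(0,0)$, ending at $(n,0)$ and never going below the $x$-axis. Write $D=(1,-1)$, $F=(1,0)$, $U_i=(1,i)$ for $i\geq1$. Steps are numbered $1,\dots,n$; an occurrence of a pattern is at position $i$ if its first step is the $i$-th step. Two paths of the same length are $\alpha$-equivalent if the sets of occurrence positions of the pattern $\alpha$ in them are identical. *)

(* Defs.v *)
From mathcomp Require Import all_boot all_order all_algebra.
From mathcomp Require Import classical_sets functions cardinality.

Set Implicit Arguments.
Unset Strict Implicit.
Unset Printing Implicit Defensive.

Import Order.TTheory GRing.Theory Num.Theory.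

Local Open Scope ring_scope.
Local Open Scope classical_set_scope.

(* The step (1, i) is represented by its second coordinate i : int, so a
   lattice path starting at (0, 0) is the sequence of these coordinates. *)
Definition stepD : int := -1.

(* The ordinate of the point with abscissa k, for k <= size p; it is
   constant in k beyond that point. *)
Definition height (p : seq int) (k : nat) : int := \sum_(s <- take k p) s.

Definition lukasiewicz (n : nat) : set (seq int) :=
  [set p | [/\ size p = n,
               forall s, s \in p -> -1 <= s,
               forall k, (k <= n)%N -> 0 <= height p k
             & height p n = 0]].

(* Steps are numbered from 1, hence the predecessor in [drop]. *)
Definition occurs_at (alpha p : seq int) (i : nat) : Prop :=
  (1 <= i <= size p)%N /\ take (size alpha) (drop i.-1 p) = alpha.

Definition occurrences (alpha p : seq int) : set nat :=
  [set i | occurs_at alpha p i].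

Definition pattern_equiv (alpha p q : seq int) : Prop :=
  size p = size q /\ occurrences alpha p = occurrences alpha q.

Definition equiv_class (alpha : seq int) (L : set (seq int)) (p : seq int) :
    set (seq int) :=
  [set q | L q /\ pattern_equiv alpha p q].

Definition equiv_classes (alpha : seq int) (L : set (seq int)) :
    set (set (seq int)) :=
  [set equiv_class alpha L p | p in L].

(* Main.v *)
(** The classes correspond to the possible sets of positions of [D]. The first
    step of a path is never [D]; conversely any set [S] of positions in
    [{2, ..., n}] is realised by the path which first rises to height [#|S|],
    then goes down at the positions in [S] and stays level elsewhere. *)

Require Import Defs.
From mathcomp Require Import all_boot all_order all_algebra.
From mathcomp Require Import classical_sets functions cardinality.
From mathcomp Require Import zify.

Local Open Scope classical_set_scope.
Import Order.TTheory GRing.Theory Num.Theory.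

Definition Dmask (p : seq int) : seq bool := [seq s == stepD | s <- p].

(** The default [false] of [nth] encodes the bound [i <= size p]; the guard [0 < i] is kept because
    [i.-1] sends both 0 and 1 to 0. *)
Lemma occurs_atD (p : seq int) (i : nat) :
  occurs_at [:: stepD] p i <-> (0 < i)%N && nth false (Dmask p) i.-1.
Proof.
rewrite /occurs_at; case: i => [|i] /=; first by split => [[]|].
have [ltip|leqpi] := ltnP i (size p); last first.
  by rewrite nth_default ?size_map //; split=> [[]|].
rewrite (nth_map 0%R) // (drop_nth 0%R) //= take0.
by split=> [[_ [->]]|/eqP ->].
Qed.

(** The mask also records the length, so one equality covers both halves of the equivalence. *)
Lemma pattern_equivD (p q : seq int) :
  pattern_equiv [:: stepD] p q <-> Dmask p = Dmask q.
Proof.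
split=> [[szpq eqpq]|eqpq]; last first.
  split; first by rewrite -(size_map (pred1 stepD)) -/(Dmask p) eqpq size_map.
  by apply/seteqP; split=> i /occurs_atD; rewrite (eqpq, esym eqpq) => /occurs_atD.
apply: (@eq_from_nth _ false) => [|i _]; first by rewrite !size_map.
have /seteqP[subpq subqp] := eqpq.
apply/idP/idP => hi.
  by have /occurs_atD := subpq i.+1 ((occurs_atD p i.+1).2 hi).
by have /occurs_atD := subqp i.+1 ((occurs_atD q i.+1).2 hi).
Qed.

Lemma eq_equiv_classD (L : set (seq int)) (p q : seq int) : L q ->
  Defs.equiv_class [:: stepD] L p = Defs.equiv_class [:: stepD] L q
  <-> Dmask p = Dmask q.
Proof.
move=> Lq; split=> [eqpq|eqpq].
  have : Defs.equiv_class [:: stepD] L q q by split.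
  by rewrite -eqpq => -[_ /pattern_equivD].
apply/seteqP; split=> r [Lr /pattern_equivD er]; split=> //; apply/pattern_equivD.
  by rewrite -eqpq.
by rewrite eqpq.
Qed.

(** Canonical representative of a class: [t] describes only the steps after the first, which rises
    just enough to pay for every later [D]. *)
Definition path_of_mask (t : seq bool) : seq int :=
  Posz (count id t) :: [seq if b then stepD else 0%R | b <- t].

Lemma Dmask_path_of_mask (t : seq bool) : Dmask (path_of_mask t) = false :: t.
Proof.
rewrite /Dmask /= -map_comp; congr cons.
by rewrite -[RHS]map_id; apply: eq_map => -[].
Qed.

(** Each [D] already met has used up one unit of the initial rise, so what remains counts the [D]
    still to come: never negative, and 0 at the end. *)
Lemma height_path_of_mask (t : seq bool) (k : nat) :
  height (path_of_mask t) k.+1 = Posz (count id (drop k t)).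
Proof.
rewrite /height /= big_cons -map_take big_map -{1}(cat_take_drop k t) count_cat.
elim: (take k t) => [|b u IHu]; first by rewrite big_nil addr0.
by rewrite big_cons -[RHS]IHu /stepD; case: b => /=; lia.
Qed.

Lemma lukasiewicz_path_of_mask (t : seq bool) :
  lukasiewicz (size t).+1 (path_of_mask t).
Proof.
split=> [|s||]; first by rewrite /= size_map.
- by rewrite inE => /orP[/eqP -> //|/mapP[[] _ ->]].
- by case=> [|k] _; [rewrite /height take0 big_nil|rewrite height_path_of_mask].
- by rewrite height_path_of_mask drop_size.
Qed.

(** An initial [D] would give height -1 at abscissa 1. Hence only [n] of the [n.+1] letters of the
    mask are free. *)
Lemma Dmask_lukasiewicz (n : nat) (p : seq int) : lukasiewicz n.+1 p ->
  exists t : n.-tuple bool, Dmask p = false :: t.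
Proof.
case: p => [|s p] [//= [szp] _ /(_ 1%N isT)].
rewrite /height /= take0 big_seq1 => s_ge0 _.
have szt : size (Dmask p) == n by rewrite size_map szp.
exists (Tuple szt); congr cons.
by apply/eqP => es; rewrite es in s_ge0.
Qed.

Theorem theorem3 (n : nat) (hn : (1 <= n)%N) :
  (equiv_classes [:: stepD] (lukasiewicz n) #= `I_(2 ^ (n - 1)))%card.
Proof.
case: n hn => // n _; rewrite subn1 /=.
have Lmask (t : n.-tuple bool) : lukasiewicz n.+1 (path_of_mask t).
  by have := lukasiewicz_path_of_mask t; rewrite size_tuple.
pose f (t : n.-tuple bool) :=
  Defs.equiv_class [:: stepD] (lukasiewicz n.+1) (path_of_mask t).
(* Every class is that of the canonical path with the same mask, so [f] reaches all classes. *)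
have -> : equiv_classes [:: stepD] (lukasiewicz n.+1) = f @` setT.
  apply/seteqP; split=> C; last by case=> t _ <-; exists (path_of_mask t).
  case=> p Lp <-; have [t et] := Dmask_lukasiewicz _ _ Lp.
  by exists t => //; apply/eq_equiv_classD; rewrite // Dmask_path_of_mask.
have f_inj : {in setT &, injective f}.
  move=> t u _ _ /(eq_equiv_classD _ _ _ (Lmask u)).
  by rewrite !Dmask_path_of_mask => -[/val_inj].
apply: card_eq_trans (inj_card_eq f_inj) _.
(* Reading [2 ^ n] as the cardinal of [n.-tuple bool] lets [enum_rank] serve as the bijection onto
   the ordinals. *)
rewrite -card_bool -card_tuple; apply: card_eq_trans (card_esym card_II).
have rank_inj : {in @setT (n.-tuple bool) &, injective enum_rank}.
  by move=> t u _ _ /enum_rank_inj.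
rewrite -(card_eql (inj_card_eq rank_inj)).
have -> : [set enum_rank t | t in @setT (n.-tuple bool)] = setT.
  by apply/seteqP; split=> // i _; exists (enum_val i); rewrite ?enum_valK.
exact: card_eqxx.
Qed.
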